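(* For every mixed fair division instance with two agents ($n=2$) and type-normalized additive valuations, an EQ1 complete allocation exists, and one can be computed in polynomial time.
   Context: A (mixed) fair division instance $([n],[m],\mathcal{V})$ consists of $n$ agents, a set $O=[m]$ of $m$ indivisible items, and valuations $\mathcal{V}=\{v_1,\dots,v_n\}$ with $v_i:2^{[m]}\to\mathbb{Z}$ additive: $v_i(S)=\sum_{o\in S}v_i(o)$. Values may be positive, negative or zero. A (complete) allocation $A=(A_1,\dots,A_n)$ is a partition of the set of all items into $n$ (possibly empty) bundles, $A_i$ going to agent $i$. An instance is type-normalized if there are constants $g$ and $c$ such that for every agent $i$, $\sum_{o:\,v_i(o)\ge 0}v_i(o)=g$ and $\sum_{o:\,v_i(o)\le 0}v_i(o)=c$. An allocation $A$ is EQ1 (equitable up to one item) if for every pair of agents $i,j$ with $v_i(A_i)<v_j(A_j)$, either there exists $g\in A_j$ with $v_j(g)\ge 0$ such that $v_i(A_i)\ge v_j(A_j\setminus\{g\})$, or there exists $c\in A_i$ with $v_i(c)\le 0$ such that $v_i(A_i\setminus\{c\})\ge v_j(A_j)$. *)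

(* Defs.v *)
From mathcomp Require Import all_boot all_order all_algebra.

Set Implicit Arguments.
Unset Strict Implicit.
Unset Printing Implicit Defensive.

Import Order.TTheory GRing.Theory Num.Theory.
Local Open Scope ring_scope.

(** * Fair division with [n] agents ['I_n] and [m] items ['I_m] *)

Section FairDivision.
Variables n m : nat.
Implicit Types (v : 'I_n -> {set 'I_m} -> int) (A : 'I_n -> {set 'I_m}).

Definition additive_valuations v : Prop :=
  forall i (S : {set 'I_m}), v i S = \sum_(o in S) v i [set o].

Definition type_normalized v : Prop :=
  exists g c : int, forall i,
    \sum_(o | 0 <= v i [set o]) v i [set o] = g /\
    \sum_(o | v i [set o] <= 0) v i [set o] = c.

(* The predicate [partition] of finset would forbid empty bundles. *)
Definition allocation A : Prop :=
  (forall i j, i != j -> [disjoint A i & A j]) /\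
  \bigcup_i A i = [set: 'I_m].

Definition EQ1 v A : Prop :=
  forall i j, v i (A i) < v j (A j) ->
    (exists g, [/\ g \in A j, 0 <= v j [set g] &
                   v j (A j :\ g) <= v i (A i)]) \/
    (exists c, [/\ c \in A i, v i [set c] <= 0 &
                   v j (A j) <= v i (A i :\ c)]).

(* An instance is presented to a machine as n, m and the n x m table of the
   values of single items, row by row; an allocation as the n x m table of the
   bits "item o belongs to the bundle of agent i". *)
Definition encode_instance v : seq int :=
  n%:Z :: m%:Z :: [seq v i [set o] | i <- enum 'I_n, o <- enum 'I_m].

Definition encode_allocation A : seq int :=
  [seq (nat_of_bool (o \in A i))%:Z | i <- enum 'I_n, o <- enum 'I_m].

End FairDivision.

(** * Running time *)

(* Random access machines of Cook and Reckhow (Time bounded random access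
   machines, J. Comput. System Sci. 7, 1973), with the logarithmic cost
   criterion: registers hold integers, and an instruction costs the total bit
   length of its operands and of the indirect address it uses.  Polynomial
   time on these machines is polynomial time on Turing machines. *)

Inductive instr :=
| Const (i : nat) (c : int)    (* X_i <- c *)
| Add (i j k : nat)            (* X_i <- X_j + X_k *)
| Sub (i j k : nat)            (* X_i <- X_j - X_k *)
| LoadInd (i j : nat)          (* X_i <- X_(X_j) *)
| StoreInd (i j : nat)         (* X_(X_i) <- X_j *)
| Jpos (j l : nat)             (* go to line l if X_j > 0 *)
| Read (i : nat)               (* X_i <- next input number *)
| Print (i : nat).             (* append X_i to the output *)

Definition program := seq instr.

Record config := Config {
  pc : nat;
  reg : nat -> int;
  input : seq int;
  output : seq int
}.

Definition bitlen (x : int) : nat := (trunc_log 2 `|x|%N).+1.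

(* The next configuration and the cost of the step.  There is none when the
   line number is outside the program, when reading past the end of the input
   and when addressing a register of negative index. *)
Definition step (P : program) (s : config) : option (config * nat) :=
  let: Config l X inp out := s in
  if onth P l is Some c then
    match c with
    | Const i a =>
        Some (Config l.+1 [eta X with i |-> a] inp out, bitlen a)
    | Add i j k =>
        Some (Config l.+1 [eta X with i |-> X j + X k] inp out,
              (bitlen (X j) + bitlen (X k))%N)
    | Sub i j k =>
        Some (Config l.+1 [eta X with i |-> X j - X k] inp out,
              (bitlen (X j) + bitlen (X k))%N)
    | LoadInd i j =>
        if X j is Posz a then
          Some (Config l.+1 [eta X with i |-> X a] inp out,
                (bitlen (X j) + bitlen (X a))%N)
        else None
    | StoreInd i j =>
        if X i is Posz a then
          Some (Config l.+1 [eta X with a |-> X j] inp out,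
                (bitlen (X i) + bitlen (X j))%N)
        else None
    | Jpos j l' =>
        Some (Config (if 0 < X j then l' else l.+1) X inp out, bitlen (X j))
    | Read i =>
        if inp is a :: inp' then
          Some (Config l.+1 [eta X with i |-> a] inp' out, bitlen a)
        else None
    | Print i =>
        Some (Config l.+1 X inp (rcons out (X i)), bitlen (X i))
    end
  else None.

Inductive run (P : program) : config -> nat -> config -> Prop :=
| run_nil s : run P s 0 s
| run_cons s s' s'' k t :
    step P s = Some (s', k) -> run P s' t s'' -> run P s (k + t)%N s''.

(* Program [P] halts on input [x] with output [y] after a run of total cost
   [t]; it halts by leaving the range of its line numbers. *)
Definition computes_in (P : program) (x y : seq int) (t : nat) : Prop :=
  exists s, [/\ run P (Config 0 (fun=> 0) x [::]) t s,
                (size P <= pc s)%N & output s = y].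

Definition input_size (x : seq int) : nat := (\sum_(a <- x) bitlen a)%N.

(* Main.v *)
Require Import Defs.
From mathcomp Require Import all_boot all_order all_algebra.
From mathcomp Require Import zify.

Set Implicit Arguments.
Unset Strict Implicit.
Unset Printing Implicit Defensive.

Import Order.TTheory GRing.Theory Num.Theory.
Local Open Scope ring_scope.

(* Give the first k items to agent 0 and the rest to agent 1, and let f k be
   the difference of their values.  Type normalization makes the two agents
   agree on the value T of all items, so f runs from - T to T.  Refine the step
   from f k to f (k + 1) into two half-steps, first v_1(k) and then v_0(k), and
   stop when the refined walk first reaches or crosses 0.  If this happens in
   the half-step v_1(k), removing item k from the bundle of agent 1 would
   reverse the sign of f k, so the split at k is EQ1; if it happens in the
   half-step v_0(k), the split at k + 1 is EQ1 for the same reason applied to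
   agent 0.  The crossing is found in one pass over the two rows of values. *)

(** * Equal totals and a local criterion for EQ1 *)

Lemma type_normalized_total n m (v : 'I_n -> {set 'I_m} -> int) i j :
  additive_valuations v -> type_normalized v ->
  v i [set: 'I_m] = v j [set: 'I_m].
Proof.
move=> addv [g [c gcE]].
suff total k : v k [set: 'I_m] = g + c by rewrite !total.
have [<- <-] := gcE k.
rewrite addv big_mkcond [X in _ = X + _]big_mkcond [X in _ = _ + X]big_mkcond.
rewrite -big_split /=; apply: eq_bigr => o _; rewrite inE.
(* Items of value 0 occur in both sums and contribute nothing to either. *)
by case: ltgtP => [||<-]; rewrite ?addr0 ?add0r.
Qed.

Definition split_alloc m (S : {set 'I_m}) (i : 'I_2) : {set 'I_m} :=
  if i == ord0 then S else ~: S.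

Lemma split_allocP m (S : {set 'I_m}) : allocation (split_alloc S).
Proof.
split=> [i j|].
  rewrite -setI_eq0 /split_alloc.
  by case: i => [[|[|//]] ?]; case: j => [[|[|//]] ?] //= _; rewrite ?setICr // setIC setICr.
apply/setP => o; rewrite inE; apply/bigcupP.
case: (boolP (o \in S)) => oS; first by exists ord0.
by exists ord_max; rewrite // /split_alloc inE.
Qed.

Lemma valueD1 n m (v : 'I_n -> {set 'I_m} -> int) i (S : {set 'I_m}) o :
  additive_valuations v -> o \in S -> v i (S :\ o) = v i S - v i [set o].
Proof.
move=> addv oS; rewrite (addv i S) (big_setD1 o oS) /= -addv addrC addrK //.
Qed.

(** A walk at [x] that descends by the signed amount [y] then ends at 0 or on the other side of
    it. *)
Definition between0 (x y : int) : bool := (0 <= x <= y) || (y <= x <= 0).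

(** If [f < 0], agent 0 is the poorer one. The item of the second case is then a good of the richer
    agent, that of the third a chore of the poorer agent, and removing it makes the difference
    nonnegative. For [f > 0] goods and chores exchange roles. *)
Lemma split_alloc_EQ1 m (v : 'I_2 -> {set 'I_m} -> int) (S : {set 'I_m}) :
  additive_valuations v ->
  let f := v ord0 S - v ord_max (~: S) in
  [\/ f = 0,
      exists2 o, o \notin S & between0 (- f) (v ord_max [set o])
    | exists2 o, o \in S & between0 f (v ord0 [set o])] ->
  EQ1 v (split_alloc S).
Proof.
move=> addv f fP i j.
have ordE (k : 'I_2) : k = ord0 \/ k = ord_max.
  by case: k => [[|[|//]] ?]; [left|right]; apply: val_inj.
case: (ordE i) (ordE j) => -> [] ->; rewrite ?ltxx // /split_alloc /=.
  move=> lt01; case: fP => [|[o oS]|[o oS]]; rewrite /between0 /f.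
  - lia.
  - move=> fo; left; exists o; rewrite valueD1 ?inE //.
    by split=> //; lia.
  - move=> fo; right; exists o; rewrite valueD1 //.
    by split=> //; lia.
move=> lt10; case: fP => [|[o oS]|[o oS]]; rewrite /between0 /f.
- lia.
- move=> fo; right; exists o; rewrite valueD1 ?inE //.
  by split=> //; lia.
- move=> fo; left; exists o; rewrite valueD1 //.
  by split=> //; lia.
Qed.

(** * Running programs *)

Section Reach.
Variables (P : program) (M : nat).
Implicit Types (X : nat -> int) (inp out : seq int) (s : config).

(** Here [k] bounds the number of instructions. Each of them handles at most two numbers, and a
    number of absolute value at most [M] has at most [(trunc_log 2 M).+1] bits. *)
Definition reach (k : nat) (s s' : config) : Prop :=
  exists2 t, run P s t s' & (t <= k * (trunc_log 2 M).+1.*2)%N.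

Lemma reach_refl s : reach 0 s s.
Proof. by exists 0%N => //; apply: run_nil. Qed.

Lemma reach_le k k' s s' : (k <= k')%N -> reach k s s' -> reach k' s s'.
Proof.
move=> lek [t st let_]; exists t => //.
by apply: leq_trans let_ _; rewrite leq_mul2r lek orbT.
Qed.

Lemma run_cat s1 s2 s3 t t' :
  run P s1 t s2 -> run P s2 t' s3 -> run P s1 (t + t')%N s3.
Proof.
elim=> // {s1 s2} s s' s2 k t'' st _ IH /IH r.
by rewrite -addnA; apply: run_cons st r.
Qed.

Lemma reach_trans k k' s1 s2 s3 :
  reach k s1 s2 -> reach k' s2 s3 -> reach (k + k') s1 s3.
Proof.
move=> [t r lt_] [t' r' lt']; exists (t + t')%N; first exact: run_cat r r'.
by rewrite mulnDl leq_add.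
Qed.

Lemma bitlen_le (x : int) : (`|x| <= M)%N -> (bitlen x <= (trunc_log 2 M).+1)%N.
Proof. by move=> xM; rewrite ltnS leq_trunc_log. Qed.

Lemma reach_step1 s s1 s2 k d :
  step P s = Some (s1, d) -> (d <= (trunc_log 2 M).+1.*2)%N ->
  reach k s1 s2 -> reach k.+1 s s2.
Proof.
move=> st led [t r let_]; exists (d + t)%N; first exact: run_cons st r.
by rewrite mulSn leq_add.
Qed.

Let cost1 (x : int) :
  (`|x| <= M)%N -> (bitlen x <= (trunc_log 2 M).+1.*2)%N.
Proof. by move/bitlen_le=> ?; rewrite -addnn; apply: leq_trans (leq_addr _ _). Qed.

Let cost2 (x y : int) : (`|x| <= M)%N -> (`|y| <= M)%N ->
  (bitlen x + bitlen y <= (trunc_log 2 M).+1.*2)%N.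
Proof. by move=> /bitlen_le ? /bitlen_le ?; rewrite -addnn leq_add. Qed.

Section Instructions.
Variables (l n : nat) (X : nat -> int) (inp out : seq int) (s : config).
Local Notation here := (Config l X inp out).

(** This lemma and its analogues below prepend one instruction to a run, so applying them in program
    order executes the program symbolically. *)
Lemma reach_const i c : onth P l = Some (Const i c) -> (`|c| <= M)%N ->
  reach n (Config l.+1 [eta X with i |-> c] inp out) s -> reach n.+1 here s.
Proof. by move=> Pl cM; apply: reach_step1 (cost1 cM); rewrite /= Pl. Qed.

Lemma reach_add i j k : onth P l = Some (Add i j k) ->
  (`|X j| <= M)%N -> (`|X k| <= M)%N ->
  reach n (Config l.+1 [eta X with i |-> X j + X k] inp out) s ->
  reach n.+1 here s.
Proof. by move=> Pl jM kM; apply: reach_step1 (cost2 jM kM); rewrite /= Pl. Qed.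

Lemma reach_sub i j k : onth P l = Some (Defs.Sub i j k) ->
  (`|X j| <= M)%N -> (`|X k| <= M)%N ->
  reach n (Config l.+1 [eta X with i |-> X j - X k] inp out) s ->
  reach n.+1 here s.
Proof. by move=> Pl jM kM; apply: reach_step1 (cost2 jM kM); rewrite /= Pl. Qed.

Lemma reach_load i j p : onth P l = Some (LoadInd i j) ->
  X j = Posz p -> (p <= M)%N -> (`|X p| <= M)%N ->
  reach n (Config l.+1 [eta X with i |-> X p] inp out) s -> reach n.+1 here s.
Proof.
move=> Pl Xj pM XpM; apply: (@reach_step1 _ _ _ _ (bitlen p + bitlen (X p))).
  by rewrite /= Pl Xj.
exact: cost2.
Qed.

Lemma reach_store i j p : onth P l = Some (StoreInd i j) ->
  X i = Posz p -> (p <= M)%N -> (`|X j| <= M)%N ->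
  reach n (Config l.+1 [eta X with p |-> X j] inp out) s -> reach n.+1 here s.
Proof.
move=> Pl Xi pM XjM; apply: (@reach_step1 _ _ _ _ (bitlen p + bitlen (X j))).
  by rewrite /= Pl Xi.
exact: cost2.
Qed.

Lemma reach_jump j l' : onth P l = Some (Jpos j l') ->
  0 < X j -> (`|X j| <= M)%N ->
  reach n (Config l' X inp out) s -> reach n.+1 here s.
Proof. by move=> Pl j0 jM; apply: reach_step1 (cost1 jM); rewrite /= Pl j0. Qed.

Lemma reach_nojump j l' : onth P l = Some (Jpos j l') ->
  X j <= 0 -> (`|X j| <= M)%N ->
  reach n (Config l.+1 X inp out) s -> reach n.+1 here s.
Proof.
by move=> Pl j0 jM; apply: reach_step1 (cost1 jM); rewrite /= Pl ltNge j0.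
Qed.

Lemma reach_print i : onth P l = Some (Print i) -> (`|X i| <= M)%N ->
  reach n (Config l.+1 X inp (rcons out (X i))) s -> reach n.+1 here s.
Proof. by move=> Pl iM; apply: reach_step1 (cost1 iM); rewrite /= Pl. Qed.

Lemma reach_read i a : onth P l = Some (Read i) -> (`|a| <= M)%N ->
  reach n (Config l.+1 [eta X with i |-> a] inp out) s ->
  reach n.+1 (Config l X (a :: inp) out) s.
Proof. by move=> Pl aM; apply: reach_step1 (cost1 aM); rewrite /= Pl. Qed.

End Instructions.
End Reach.

(** * The walk normalized to start at a nonnegative value, and its bounds *)

Definition flip (t x : int) : int := if 0 < t then x else - x.

Lemma reach_flip P M l X inp out r :
  onth P l = Some (Jpos 8 l.+2) -> onth P l.+1 = Some (Defs.Sub r 0 r) ->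
  X 0%N = 0 -> (`|X 8| <= M)%N -> (`|X r| <= M)%N ->
  exists X', [/\ reach P M 2 (Config l X inp out) (Config l.+2 X' inp out),
    X' r = flip (X 8) (X r) & forall q, q != r -> X' q = X q].
Proof.
move=> Pl Pl1 X0 X8 Xr; rewrite /flip; case: (ltP 0 (X 8)) => X8s.
  exists X; split=> //; apply: reach_jump Pl X8s X8 _.
  exact: reach_le (reach_refl _ _ _).
exists [eta X with r |-> X 0%N - X r]; split.
- apply: reach_nojump Pl X8s X8 _; apply: reach_sub Pl1 _ Xr _; rewrite ?X0 //.
  exact: reach_refl.
- by rewrite /= eqxx X0 sub0r.
- by move=> q /negPf /= ->.
Qed.

(* With h = |t|, this is f k up to the sign that makes the walk start at
   [h >= 0] and end at [- h]. *)
Definition walk (t h : int) (a b : seq int) (k : nat) : int :=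
  h - \sum_(0 <= i < k) (flip t b`_i + flip t a`_i).

Definition crossing t h a b (k : nat) : Prop :=
  [\/ k = 0%N /\ h = 0,
      (k < size b)%N /\ 0 < walk t h a b k <= flip t b`_k
    | exists2 j, k = j.+1 &
        (j < size b)%N /\ walk t h a b k <= 0 < walk t h a b k + flip t a`_j].

Lemma absz_psum (a : seq int) k : (k <= size a)%N ->
  (`|(\sum_(0 <= i < k) a`_i)%R| <= \sum_(x <- a) `|x|)%N.
Proof.
elim: a k => [|x a IH] [|k] //=; try by rewrite big_geq.
move=> lek; rewrite big_nat_recl // big_cons /=; have := IH k lek.
by move: (\sum_(0 <= i < k) _) (\sum_(y <- a) _)%N => S N; lia.
Qed.

Lemma absz_nth (a : seq int) k : (k < size a)%N ->
  (`|(a`_k)%R| <= \sum_(x <- a) `|x|)%N.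
Proof. by move=> ltk; rewrite (big_rem _ (mem_nth 0 ltk)) leq_addr. Qed.

(** For [t <= 0] every term of the walk is negated, so the sign factors out; what remains is the
    difference of the two bundles' values in terms of prefix sums. *)
Lemma walkE t a b k :
  walk t `|t| a b k =
    flip t (t - (\sum_(0 <= i < k) b`_i + \sum_(0 <= i < k) a`_i)).
Proof.
rewrite /walk /flip -big_split /=; case: ltP => t0; first by rewrite gtr0_norm.
by rewrite ler0_norm // opprB addrC -sumrN; congr (_ - _); apply: eq_bigr => i _; lia.
Qed.

(* X_0 = 0 and X_1 = 1 are constants.  X_9, X_10, ... hold the values of agent
   0, X_2 is the address after the last of them and X_3 the current one.  X_8
   is T, X_4 is first the partial sum of T and then the walk, and X_5, X_6 are
   scratch.  The lines up to 11 read the values of agent 0, those from 17 to 29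
   walk and print a 1 for each item that agent 0 keeps, those from 32 to 35
   print m zeros, as the end of the row of agent 0 and the start of that of
   agent 1 contain m zeros together, and the rest prints the remaining ones. *)
Definition eq1_program : program := [::
  (* 0 *) Read 2; Read 2; Const 1 1; Const 3 9; Add 2 2 3; Jpos 1 10;
  (* 6 *) Read 5; StoreInd 3 5; Add 4 4 5; Add 3 3 1;
  (* 10 *) Defs.Sub 6 2 3; Jpos 6 6;
  (* 12 *) Add 8 4 0; Jpos 8 15; Defs.Sub 4 0 4; Const 3 9; Jpos 1 29;
  (* 17 *) Read 5; Jpos 8 20; Defs.Sub 5 0 5; Defs.Sub 4 4 5; Jpos 4 23; Jpos 1 30;
  (* 23 *) LoadInd 6 3; Jpos 8 26; Defs.Sub 6 0 6; Defs.Sub 4 4 6; Print 1; Add 3 3 1;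
  (* 29 *) Jpos 4 17;
  (* 30 *) Const 5 9; Jpos 1 34;
  (* 32 *) Print 0; Add 5 5 1;
  (* 34 *) Defs.Sub 6 2 5; Jpos 6 32; Jpos 1 39;
  (* 37 *) Print 1; Add 3 3 1;
  (* 39 *) Defs.Sub 6 2 3; Jpos 6 37].

(** * Execution of the program, loop by loop *)

Section Program.
Variable M : nat.
Hypothesis M_ge : (9 <= M)%N.
Implicit Types (X : nat -> int) (inp out a b : seq int).
Local Notation reachP := (reach eq1_program M).

(** Induction on the rounds left, [j] being those done: four instructions per round and two for the
    last test. Keeping the registers below 5 preserves the address in [X_3] at which the walk
    stopped. *)
Lemma print_zeros n X inp out j :
  X 0%N = 0 -> X 1%N = 1 -> X 2%N = (9 + j + n)%:Z -> X 5%N = (9 + j)%:Z ->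
  (9 + j + n <= M)%N ->
  exists2 X', reachP (4 * n).+2 (Config 34 X inp out)
                     (Config 36 X' inp (out ++ nseq n 0)) &
              forall q, (q < 5)%N -> X' q = X q.
Proof.
elim: n j X out => [|n IH] j X out X0 X1 X2 X5 leM.
  exists [eta X with 6%N |-> X 2%N - X 5%N]; last by do 5?[case=> //].
  apply: reach_sub => //=; rewrite ?X2 ?X5; try lia.
  apply: reach_nojump => //=; rewrite ?X2 ?X5; try lia.
  by rewrite cats0; apply: reach_refl.
pose Y := [eta X with 6%N |-> X 2%N - X 5%N].
have [||||| X' rX' X'E] := IH j.+1 [eta Y with 5%N |-> Y 5%N + Y 1%N] (rcons out 0).
- by [].
- by [].
- by rewrite /= X2; congr Posz; lia.
- by rewrite /= X5 X1; lia.
- lia.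
exists X'; last by do 5?[case=> [_|]] => //; rewrite X'E.
have -> : (4 * n.+1).+2 = ((4 * n).+2).+4 by lia.
apply: reach_sub => //=; rewrite ?X2 ?X5; try lia.
apply: reach_jump => //=; rewrite ?X2 ?X5; try lia.
apply: reach_print => //=; rewrite ?X0 //.
apply: reach_add => //=; rewrite ?X1 ?X5; try lia.
by move: rX'; rewrite /Y /= X2 X5 X1 cat_rcons.
Qed.

Lemma print_ones n X inp out j :
  X 0%N = 0 -> X 1%N = 1 -> X 2%N = (9 + j + n)%:Z -> X 3%N = (9 + j)%:Z ->
  (9 + j + n <= M)%N ->
  exists X', reachP (4 * n).+2 (Config 39 X inp out)
                    (Config 41 X' inp (out ++ nseq n 1)).
Proof.
elim: n j X out => [|n IH] j X out X0 X1 X2 X3 leM.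
  exists [eta X with 6%N |-> X 2%N - X 3%N].
  apply: reach_sub => //=; rewrite ?X2 ?X3; try lia.
  apply: reach_nojump => //=; rewrite ?X2 ?X3; try lia.
  by rewrite cats0; apply: reach_refl.
pose Y := [eta X with 6%N |-> X 2%N - X 3%N].
have [||||| X' rX'] := IH j.+1 [eta Y with 3%N |-> Y 3%N + Y 1%N] (rcons out 1).
- by [].
- by [].
- by rewrite /= X2; congr Posz; lia.
- by rewrite /= X3 X1; lia.
- lia.
exists X'.
have -> : (4 * n.+1).+2 = ((4 * n).+2).+4 by lia.
apply: reach_sub => //=; rewrite ?X2 ?X3; try lia.
apply: reach_jump => //=; rewrite ?X2 ?X3; try lia.
apply: reach_print => //=; rewrite ?X1; try lia.
apply: reach_add => //=; rewrite ?X1 ?X3; try lia.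
by move: rX'; rewrite /Y /= X2 X3 X1 cat_rcons.
Qed.

(** The clause on addresses below [9 + j] lets the value stored in one round survive the later ones.
    The bound on absolute values controls every partial sum in [X_4]. *)
Lemma read_loop a X inp out j :
  X 1%N = 1 -> X 2%N = (9 + j + size a)%:Z -> X 3%N = (9 + j)%:Z ->
  (9 + j + size a <= M)%N -> (`|X 4%N| + \sum_(x <- a) `|x| <= M)%N ->
  exists X',
    [/\ reachP (6 * size a).+2 (Config 10 X (a ++ inp) out) (Config 12 X' inp out),
        X' 4%N = X 4%N + \sum_(x <- a) x,
        forall i, (i < size a)%N -> X' (9 + j + i)%N = a`_i,
        forall q, (8 < q < 9 + j)%N -> X' q = X q
      & [/\ X' 0%N = X 0%N, X' 1%N = 1 & X' 2%N = X 2%N]].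
Proof.
elim: a j X => [|x a IH] j X X1 /= X2 X3 lejM sumM.
  exists [eta X with 6%N |-> X 2%N - X 3%N].
  rewrite big_nil addr0; split=> //=.
    apply: reach_sub => //=; rewrite ?X2 ?X3; try lia.
    apply: reach_nojump => //=; rewrite ?X2 ?X3; try lia.
    exact: reach_refl.
  by move=> q; case: eqP => // ->.
rewrite big_cons in sumM.
pose Y := [eta X with 6%N |-> X 2%N - X 3%N].
pose Z := [eta [eta Y with 5%N |-> x] with (9 + j)%N |-> x].
pose W := [eta Z with 4%N |-> X 4%N + x].
(* Storing at [9 + j] never hits a working register. *)
have low q : (q < 9)%N -> (q == 9 + j)%N = false by lia.
have [||||| X' [rX' X'4 X'a X'out X'lo]] := IH j.+1 [eta W with 3%N |-> X 3%N + 1].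
- by [].
- by rewrite /= X2; congr Posz; lia.
- by rewrite /= X3; lia.
- lia.
- by rewrite /=; lia.
exists X'; split.
- have -> : (6 * (size a).+1).+2 = (6 * size a).+2.+4.+2 by lia.
  apply: reach_sub => //=; rewrite ?X2 ?X3; try lia.
  apply: reach_jump => //=; rewrite ?X2 ?X3; try lia.
  apply: reach_read => //=; try lia.
  apply: (@reach_store _ _ _ _ _ _ _ _ _ _ (9 + j)%N) => //=; try lia.
  apply: reach_add => //=; rewrite ?low //=; try lia.
  apply: reach_add => //=; rewrite ?low //= ?X1 ?X3; try lia.
  by move: rX'; rewrite /W /Z /Y /= X2 X3.
- by rewrite X'4 /= big_cons addrA.
- case=> [_|i lti] /=.
    by rewrite addn0 X'out /= ?eqxx //; lia.
  by rewrite addnS -addSn -addnS X'a.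
- move=> q /andP[q8 qj]; rewrite X'out /=; last lia.
  by do 9?[case: q q8 qj => // q q8 qj]; rewrite ifN //; lia.
- by case: X'lo => -> -> ->.
Qed.

(** The invariant at the loop test is that a walk already at or below 0 has just crossed. A full
    round takes 5 instructions for the half-step of [b] and 7 for that of [a]; [w (size b) <= 0]
    forces a stop before the items run out. *)
Lemma walk_loop n t h a b X out j :
  let w := walk t h a b in
  size b = (j + n)%N -> (9 + size b <= M)%N -> (`|t| <= M)%N ->
  (forall i, (i < size b)%N -> (`|(a`_i)%R| <= M)%N /\ (`|(b`_i)%R| <= M)%N) ->
  (forall i, (i <= size b)%N -> (`|w i| <= M)%N) ->
  (forall i, (i < size b)%N -> (`|(w i - flip t b`_i)%R| <= M)%N) ->
  (w j <= 0 -> crossing t h a b j) -> w (size b) <= 0 ->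
  X 0%N = 0 -> X 1%N = 1 -> X 2%N = (9 + size b)%:Z -> X 3%N = (9 + j)%:Z ->
  X 4%N = w j -> X 8%N = t ->
  (forall i, (i < size b)%N -> X (9 + i)%N = a`_i) ->
  exists k X' inp',
    [/\ reachP (12 * n).+1 (Config 29 X (drop j b) out)
               (Config 30 X' inp' (out ++ nseq (k - j) 1)),
        (j <= k <= size b)%N, crossing t h a b k
      & [/\ X' 0%N = 0, X' 1%N = 1, X' 2%N = (9 + size b)%:Z &
            X' 3%N = (9 + k)%:Z]].
Proof.
move=> w; elim: n j X out => [|n IH] j X out szb szM tM abM wM wbM crj wend
  X0 X1 X2 X3 X4 X8 Xa.
(* If the walk is at or below 0, the loop test exits at once with [k = j]. *)
all: case: (lerP (w j) 0) => wj.
all: try (exists j, X, (drop j b); rewrite subnn cats0; split=> //;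
  [ apply: reach_nojump => //; rewrite ?X4 //; [by apply: wM; lia|];
    by apply: reach_le (reach_refl _ _ _)
  | lia | exact: crj ]).
  by move: wend; rewrite szb addn0 leNgt wj.
have ltj : (j < size b)%N by lia.
have [ajM bjM] := abM j ltj.
have wjM := wM j (ltnW ltj); have wSM := wM j.+1 ltj; have wbjM := wbM j ltj.
have wS : w j.+1 = w j - flip t b`_j - flip t a`_j.
  by rewrite /w /walk big_nat_recr //= -addrA -opprD -addrA -opprD addrA.
have flipM x : (`|x| <= M)%N -> (`|flip t x| <= M)%N.
  by rewrite /flip; case: ifP => //; rewrite abszN.
have -> : (12 * n.+1).+1 = (12 * n).+1.+4.+4.+4 by lia.
rewrite (drop_nth 0 ltj).
have [Y [rY Y4 YE]] : exists Y,
    [/\ reachP 5 (Config 29 X (b`_j :: drop j.+1 b) out)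
                 (Config 21 Y (drop j.+1 b) out),
        Y 4%N = w j - flip t b`_j
      & forall q, q != 4 -> q != 5 -> Y q = X q].
  have [|||||Z [rZ Z5 ZE]] := @reach_flip eq1_program M 18
    [eta X with 5%N |-> b`_j] (drop j.+1 b) out 5; rewrite //= ?X8 //.
  exists [eta Z with 4%N |-> Z 4%N - Z 5%N]; split=> /=.
  - apply: reach_jump => //; rewrite ?X4 //.
    apply: reach_read => //.
    apply: (reach_trans rZ (k' := 1)).
    apply: reach_sub => //; rewrite ?Z5 ?ZE //= ?X4 ?X8 ?flipM //.
    exact: reach_refl.
  - by rewrite Z5 ZE //= X4 X8.
  - by move=> q /negPf q4 /[dup] /negPf q5 /ZE; rewrite q4 /= q5.
(* If the half-step of [b] crosses, the loop exits before printing, so item [j] stays with agent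
   1. *)
case: (lerP (w j - flip t b`_j) 0) => wb.
  exists j, Y, (drop j.+1 b); rewrite subnn cats0; split=> //.
  - have -> : ((12 * n).+1.+4.+4.+4 = 5 + (12 * n).+4.+4)%N by lia.
    apply: reach_trans rY _.
    apply: reach_nojump => //; rewrite ?Y4 //.
    apply: reach_jump => //; rewrite ?YE ?X1 //; first by lia.
    exact: reach_le (reach_refl _ _ _).
  - by rewrite leqnn ltnW.
  - by apply: Or32; split=> //; rewrite -/w wj; lia.
  - by rewrite !YE.
have [Z [rZ Z4 Z3 ZE]] : exists Z,
    [/\ reachP 7 (Config 21 Y (drop j.+1 b) out)
                 (Config 29 Z (drop j.+1 b) (rcons out 1)),
        Z 4%N = w j.+1, Z 3%N = (9 + j.+1)%:Z
      & forall q, q != 3 -> q != 4 -> q != 5 -> q != 6 -> Z q = X q].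
  have [|||||Z [rZ Z6 ZE]] := @reach_flip eq1_program M 24
    [eta Y with 6%N |-> a`_j] (drop j.+1 b) out 6;
    rewrite //= ?YE ?X8 ?X0 //.
  have {}Z6 : Z 6%N = flip t a`_j by rewrite Z6 /= YE // X8.
  have Z1 : Z 1%N = 1 by rewrite ZE //= YE.
  have Z3 : Z 3%N = (9 + j)%:Z by rewrite ZE //= YE.
  have Z4 : Z 4%N = w j - flip t b`_j by rewrite ZE /=.
  pose U := [eta Z with 4%N |-> Z 4%N - Z 6%N].
  exists [eta U with 3%N |-> U 3%N + U 1%N]; split=> /=.
  - apply: reach_jump => //; rewrite ?Y4 //.
    apply: (@reach_load _ _ _ _ _ _ _ _ _ _ (9 + j)%N) => //; rewrite ?YE ?Xa //.
      lia.
    apply: (reach_trans rZ (k' := 3)).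
    apply: reach_sub => //; rewrite ?Z4 ?Z6 ?flipM //.
    apply: reach_print => //=; rewrite Z1; first lia.
    apply: reach_add => //=; rewrite ?Z1 ?Z3; try lia.
    by rewrite /U Z4 Z6; apply: reach_refl.
  - by rewrite Z4 Z6 wS.
  - by rewrite Z3 Z1; lia.
  - by move=> q /negPf q3 /[dup] /negPf q4 /YE q4' /[dup] /negPf q5 /q4' Yq
       /[dup] /negPf q6 /ZE; rewrite q3 q4 => -> /=; rewrite q6.
have wX q : (8 < q)%N -> Z q = X q by move=> q8; apply: ZE; lia.
have [||||||||||||||| k [X' [inp' [rX' jk crk X'E]]]] :=
  IH j.+1 Z (rcons out 1); rewrite ?Z3 ?Z4 ?ZE //; try lia.
(* The value between the half-steps was positive, so a nonpositive [w j.+1] means that the half-step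
   of [a] crossed. *)
- by move=> wS0; apply: Or33; exists j => //; split=> //; rewrite -/w wS0 wS /= subrK.
- by move=> i lti; rewrite wX ?Xa //; lia.
exists k, X', inp'; split=> //; last by lia.
have -> : ((12 * n).+1.+4.+4.+4 = 5 + (7 + (12 * n).+1))%N by lia.
apply: reach_trans rY _; apply: reach_trans rZ _.
have -> : (k - j = (k - j.+1).+1)%N by lia.
by rewrite -cat_rcons.
Qed.

(** In the bound on [M], [9 + m] covers the addresses. The walk is at most [|T|] plus both absolute
    sums, where [|T|] is at most that of [a]; a half-step may add one more entry of [b]. *)
Lemma eq1_program_run a b :
  let T := \sum_(x <- a) x in
  let m := size a in
  size b = m -> \sum_(x <- b) x = T ->
  (9 + m + 2 * (\sum_(x <- a) `|x| + \sum_(x <- b) `|x|) <= M)%N ->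
  exists k, [/\ (k <= m)%N, crossing T `|T| a b k & exists X inp,
    reachP (26 * m + 21) (Config 0 (fun=> 0) (2%:Z :: m%:Z :: a ++ b) [::])
      (Config 41 X inp (nseq k 1 ++ nseq m 0 ++ nseq (m - k) 1))].
Proof.
move=> T m szb sumb leM.
have sumE (c : seq int) : \sum_(x <- c) x = \sum_(0 <= i < size c) c`_i.
  by rewrite (big_nth 0).
have TM : (`|T| <= \sum_(x <- a) `|x|)%N by rewrite /T sumE absz_psum.
(* The registers after the setup: [X_2] receives the number of agents, then [m], then the end
   address. *)
pose Y0 : nat -> int := [eta [eta [eta [eta [eta (fun=> 0)
  with 2%N |-> 2%:Z] with 2%N |-> m%:Z] with 1%N |-> 1] with 3%N |-> 9%:Z]
  with 2%N |-> m%:Z + 9%:Z].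
have [||||| Y [rY Y4 Ya _ [Y0E Y1 Y2]]] := @read_loop a Y0 b [::] 0.
- by [].
- by rewrite /= addn0 addnC.
- by [].
- lia.
- by rewrite /=; lia.
rewrite /= add0r -/T in Y4; rewrite /Y0 /= in Y0E; have {}Y2 : Y 2%N = (9 + m)%:Z by rewrite Y2 /Y0 /=; lia.
pose U := [eta Y with 8%N |-> Y 4%N + Y 0%N].
have [|||||Z [rZ Z4 ZE]] := @reach_flip eq1_program M 13 U b [::] 4;
  rewrite //= ?Y4 ?Y0E ?addr0 //; try lia.
rewrite /= Y4 Y0E addr0 in Z4.
pose W : nat -> int := [eta Z with 3%N |-> 9%:Z].
have wE k : walk T `|T| a b k =
    flip T (T - (\sum_(0 <= i < k) b`_i + \sum_(0 <= i < k) a`_i)) by apply: walkE.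
have flip_le x : `|flip T x|%N = `|x|%N by rewrite /flip; case: ifP => //; rewrite abszN.
have bd k : (k <= m)%N ->
    (`|walk T `|T| a b k| <= 2 * \sum_(x <- a) `|x| + \sum_(x <- b) `|x|)%N.
  move=> lek; rewrite wE flip_le.
  have := @absz_psum a k lek; have := @absz_psum b k; rewrite szb => /(_ lek); lia.
have [||||||||||||||| k [X [inp [rX jk crk [X0 X1 X2 X3]]]]] :=
  @walk_loop m T `|T| a b W [::] 0.
- by [].
- by rewrite szb; lia.
- lia.
- move=> i; rewrite szb => lti; have := @absz_nth a i lti.
  by have := @absz_nth b i; rewrite szb => /(_ lti); lia.
- by move=> i; rewrite szb => /bd; lia.
- move=> i; rewrite szb => lti; have := @absz_nth b i; rewrite szb => /(_ lti).
  by have := bd i (ltnW lti); have := flip_le b`_i; lia.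
- rewrite /walk big_geq // subr0 => T0; apply: Or31; split=> //.
  by apply/eqP; rewrite eq_le T0 normr_ge0.
(* Both rows sum to [T], so the walk ends at [- |T|]. *)
- by rewrite wE -sumE sumb szb -sumE -/T /flip; case: ltP; lia.
- by rewrite /W /= ZE //= Y0E.
- by rewrite /W /= ZE //= Y1.
- by rewrite /W /= ZE //= Y2 szb.
- by [].
- rewrite /W /= Z4 /walk big_geq // subr0 /flip.
  by case: ltP => T0; [rewrite gtr0_norm|rewrite ler0_norm].
- by rewrite /W /= ZE //= Y4 Y0E addr0.
- by move=> i; rewrite szb => lti; rewrite /W /= ZE //= Ya.
rewrite subn0 drop0 /= in rX; rewrite szb in jk X2.
pose V := [eta X with 5%N |-> 9%:Z].
have [||||| V' rV V'E] := @print_zeros m V inp (nseq k 1) 0; rewrite //=.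
  lia.
have [||||| V2 rV2] := @print_ones (m - k) V' inp (nseq k 1 ++ nseq m 0) k;
  rewrite ?V'E //=.
- by rewrite X2; congr Posz; lia.
- lia.
exists k; split=> //; exists V2, inp.
(* The summands follow the program: setup, reading, storing and normalizing [T], walking, and the
   two printing loops, with the instructions that link them. *)
apply: (@reach_le _ _ (6 + ((6 * m).+2 + (1 + (2 + (2 + ((12 * m).+1 + (2 +
  ((4 * m).+2 + (1 + (4 * (m - k)).+2))))))))))%N; first lia.
apply: reach_read => //; first lia.
apply: reach_read => //; first lia.
apply: reach_const => //; first lia.
apply: reach_const => //.
apply: reach_add => //=; try lia.
apply: reach_jump => //=; try lia.
apply: reach_trans rY _.
apply: reach_add => //; [by rewrite Y4; lia|by rewrite Y0E|].
apply: reach_trans rZ _.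
apply: reach_const => //.
apply: reach_jump => //=; rewrite ?ZE //= ?Y1 //; try lia.
apply: reach_trans rX _.
apply: reach_const => //.
apply: reach_jump => //=; rewrite ?X1 //; try lia.
apply: reach_trans rV _.
apply: reach_jump => //=; rewrite ?V'E //= ?X1 //; try lia.
by rewrite catA.
Qed.

End Program.

(** * Correctness of the program *)

Definition value_row m (v : 'I_2 -> {set 'I_m} -> int) (i : 'I_2) : seq int :=
  [seq v i [set o] | o <- enum 'I_m].

Definition first_items m k : {set 'I_m} := [set o : 'I_m | (o < k)%N].

Section Prefixes.
Variables (m : nat) (v : 'I_2 -> {set 'I_m} -> int).
Hypothesis addv : additive_valuations v.

Lemma size_value_row i : size (value_row v i) = m.
Proof. by rewrite size_map size_enum_ord. Qed.

Lemma nth_value_row i (o : 'I_m) : (value_row v i)`_o = v i [set o].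
Proof. by rewrite (nth_map o) ?size_enum_ord // nth_ord_enum. Qed.

Lemma value_row_psum i k : (k <= m)%N ->
  \sum_(0 <= j < k) (value_row v i)`_j = v i (first_items m k).
Proof.
move=> lek; rewrite big_mkord (big_ord_widen m (fun j => (value_row v i)`_j) lek) addv.
by apply: eq_big => o; rewrite ?inE // nth_value_row.
Qed.

Lemma sum_value_row i : \sum_(x <- value_row v i) x = v i [set: 'I_m].
Proof.
rewrite big_map big_enum /= [RHS]addv.
by apply: eq_bigl => o; rewrite !inE.
Qed.

Lemma valueC i (S : {set 'I_m}) : v i (~: S) = v i [set: 'I_m] - v i S.
Proof.
by rewrite !(addv i) [X in _ = X - _](big_setID S) /= setTI setTD addrAC subrr add0r.
Qed.

(** The walk at [k] is [- f] up to the sign of [T], and [between0] is invariant under a common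
    change of sign, so the clauses of [crossing] become the cases of [split_alloc_EQ1]. *)
Lemma crossing_EQ1 k :
  v ord_max [set: 'I_m] = v ord0 [set: 'I_m] -> (k <= m)%N ->
  let T := v ord0 [set: 'I_m] in
  crossing T `|T| (value_row v ord0) (value_row v ord_max) k ->
  EQ1 v (split_alloc (first_items m k)).
Proof.
move=> eqT lek T cr; apply: split_alloc_EQ1 => //=.
have wE : walk T `|T| (value_row v ord0) (value_row v ord_max) k =
    flip T (- (v ord0 (first_items m k) - v ord_max (~: first_items m k))).
  by rewrite walkE !value_row_psum // valueC eqT; congr flip; rewrite -/T; lia.
move: cr wE; rewrite /crossing size_value_row.
move: (walk _ _ _ _ k) => w [[k0 T0]|[ltk]|[j kE [ltj]]].
- move=> _; apply: Or31; subst k.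
  have -> : first_items m 0 = set0 by apply/setP => o; rewrite !inE.
  have v0 i : v i set0 = 0 by rewrite addv big_set0.
  by rewrite valueC !v0 eqT -/T; lia.
- rewrite -[k]/(nat_of_ord (Ordinal ltk)) nth_value_row => wb wE; apply: Or32.
  exists (Ordinal ltk); first by rewrite inE /= ltnn.
  move: (v _ _ - v _ _) (v ord_max _) wb wE => f y.
  by rewrite /flip /between0; case: ifP => _; lia.
- rewrite -[j]/(nat_of_ord (Ordinal ltj)) nth_value_row => wa wE; apply: Or33.
  exists (Ordinal ltj); first by rewrite inE kE /=.
  move: (v _ _ - v _ _) (v ord0 [set Ordinal ltj]) wa wE => f y.
  by rewrite /flip /between0; case: ifP => _; lia.
Qed.

(** * Input and output encodings *)

Lemma enum_ord2 : enum 'I_2 = [:: ord0; ord_max].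
Proof.
by apply: (inj_map val_inj); rewrite val_enum_ord.
Qed.

Lemma encode_instanceE :
  encode_instance v = 2%:Z :: m%:Z :: value_row v ord0 ++ value_row v ord_max.
Proof. by rewrite /encode_instance enum_ord2 /= cats0. Qed.

Lemma encode_first_items k : (k <= m)%N ->
  encode_allocation (split_alloc (first_items m k)) =
  nseq k 1 ++ nseq m 0 ++ nseq (m - k) 1.
Proof.
move=> lek; rewrite /encode_allocation enum_ord2 /= cats0.
(* The first [m - k] zeros end the row of agent 0, the other [k] start that of agent 1. *)
have -> : nseq m (0 : int) = nseq (m - k) 0 ++ nseq k 0.
  by rewrite -nseqD subnK.
have rowE (F : nat -> int) : [seq F (val o) | o <- enum 'I_m] = mkseq F m.
  by rewrite /mkseq -val_enum_ord -map_comp.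
have cutE (x y : int) :
    mkseq (fun j => if (j < k)%N then x else y) m = nseq k x ++ nseq (m - k) y.
  apply: (@eq_from_nth _ 0); first by rewrite size_mkseq size_cat !size_nseq subnKC.
  move=> j; rewrite size_mkseq => ltj; rewrite nth_mkseq // nth_cat size_nseq !nth_nseq.
  by case: ltnP => // lekj; rewrite ltn_sub2r // (leq_ltn_trans lekj).
rewrite -catA catA -!cutE -!rowE; congr (_ ++ _); apply: eq_map => o;
  by rewrite /split_alloc /= !inE; case: ltnP.
Qed.

End Prefixes.

(** * Bounds in terms of the input size *)

Lemma absz_lt_bitlen (x : int) : (`|x| < 2 ^ bitlen x)%N.
Proof. exact: trunc_log_ltn. Qed.

(** Bit lengths add, so their powers of 2 multiply, and [x < C] and [A < B] give [x + A < C * B] for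
    natural numbers. *)
Lemma sum_absz_input_size (s : seq int) : (\sum_(x <- s) `|x| < 2 ^ input_size s)%N.
Proof.
rewrite /input_size; elim: s => [|x s IH]; rewrite ?big_nil // !big_cons expnD.
have := absz_lt_bitlen x; move: IH.
move: (\sum_(y <- s) _)%N (2 ^ _)%N (2 ^ _)%N => A B C; nia.
Qed.

Lemma size_input_size (s : seq int) : (size s <= input_size s)%N.
Proof.
rewrite /input_size; elim: s => [|x s IH]; rewrite ?big_nil // big_cons /=.
by rewrite addSn ltnS (leq_trans IH) // leq_addl.
Qed.

(** The [26 * m + 21] instructions are at most [26 * (N + 3)], and each costs at most [2 * (N + 3)]
    because [M < 2 ^ (N + 3)]. *)
Lemma eq1_program_correct m (v : 'I_2 -> {set 'I_m} -> int) :
  additive_valuations v -> type_normalized v ->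
  let N := input_size (encode_instance v) in
  exists (A : 'I_2 -> {set 'I_m}) (t : nat),
    [/\ allocation A, EQ1 v A,
        computes_in eq1_program (encode_instance v) (encode_allocation A) t
      & (t <= (N + 3) ^ 2 * 52)%N].
Proof.
move=> addv tnv N.
have eqT := type_normalized_total ord_max ord0 addv tnv.
pose M := (9 + m + 2 * (\sum_(x <- value_row v ord0) `|x| + \sum_(x <- value_row v ord_max) `|x|))%N.
have [|||| k [lek crk [X [inp [t rt let_]]]]] :=
  @eq1_program_run M _ (value_row v ord0) (value_row v ord_max).
- by rewrite /M; lia.
- by rewrite !size_value_row.
- by rewrite !sum_value_row.
- by rewrite size_value_row.
rewrite size_value_row in lek rt let_; rewrite sum_value_row // in crk.
exists (split_alloc (first_items m k)), t; split.
- exact: split_allocP.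
- exact: crossing_EQ1 crk.
- exists (Config 41 X inp (encode_allocation (split_alloc (first_items m k)))).
  by rewrite encode_instanceE encode_first_items.
(* Each of the [2 * m + 2] numbers of the input has at least one bit. *)
have leN : (m + m + 2 <= N)%N.
  have := size_input_size (encode_instance v).
  by rewrite -/N encode_instanceE /= size_cat !size_value_row; lia.
have ltM : (M < 2 ^ (N + 3))%N.
  have := sum_absz_input_size (encode_instance v).
  rewrite -/N encode_instanceE !big_cons big_cat /= expnD /M.
  by move: (2 ^ N)%N (\sum_(y <- _) _)%N (\sum_(y <- _) _)%N => B C D; lia.
have leL : (trunc_log 2 M < N + 3)%N.
  by rewrite -(ltn_exp2l (m := 2)) // (leq_ltn_trans (trunc_logP _ _)).
apply: leq_trans let_ _.
have -> : ((N + 3) ^ 2 * 52 = (26 * (N + 3)) * (N + 3).*2)%N by lia.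
by apply: leq_mul; rewrite ?leq_double //; lia.
Qed.

Theorem theorem4p6 :
  (forall (m : nat) (v : 'I_2 -> {set 'I_m} -> int),
     additive_valuations v -> type_normalized v ->
     exists A : 'I_2 -> {set 'I_m}, allocation A /\ EQ1 v A) /\
  (exists (P : program) (p : {poly nat}),
     forall (m : nat) (v : 'I_2 -> {set 'I_m} -> int),
       additive_valuations v -> type_normalized v ->
       exists (A : 'I_2 -> {set 'I_m}) (t : nat),
         [/\ allocation A, EQ1 v A,
             computes_in P (encode_instance v) (encode_allocation A) t &
             (t <= (p.[input_size (encode_instance v)])%R)%N]).
Proof.
split=> [m v addv tnv|].
  by have [A [t [allA eqA _ _]]] := eq1_program_correct addv tnv; exists A.
exists eq1_program, (('X + 3%N%:P) ^+ 2 * 52%N%:P) => m v addv tnv.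
have [A [t [allA eqA cA let_]]] := eq1_program_correct addv tnv.
by exists A, t; split=> //; rewrite !hornerE.
Qed.
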